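(* For a monoid $A$ and an ideal $I$ of $A$, set $I^{int}:=\{x\in A\mid\exists\,n\in\mathbb{N}\text{ such that }x^n\in I^n\}$, where $I^n:=\{\prod_{i=1}^n x_i\mid x_i\in I\}$. Then: (1) $I\mapsto I^{int}$ defines a closure operation on the collection of all ideals of $A$ (the integral closure). (2) Integral closure is persistent on the category of all monoids and commutes with localization.
   Context: $\mathbb{N}=\{1,2,\ldots\}$. A monoid means a commutative monoid, written multiplicatively, with identity $1$ and a base point $0$ satisfying $0\cdot a=0$; morphisms preserve products, $1$ and $0$. An ideal $I\subseteq A$ is a subset containing $0$ with $IA\subseteq I$. A closure operation on the set of ideals of $A$ is a map $I\mapsto I^{cl}$ from this set to itself with $I\subseteq I^{cl}$; $I\subseteq J\Rightarrow I^{cl}\subseteq J^{cl}$; $(I^{cl})^{cl}=I^{cl}$. Let $cl$ be a closure operation defined on the ideals of all monoids in a subcategory $\mathcal{M}$ of the category of monoids. It is persistent on $\mathcal{M}$ if for every morphism $\phi:A\to B$ in $\mathcal{M}$ and every ideal $I$ of $A$, $\phi(I^{cl})B\subseteq(\phi(I)B)^{cl}$. A persistent $cl$ commutes with localization in $\mathcal{M}$ if for every $A\in\mathcal{M}$ and every multiplicative set $S\subseteq A$ such that the localization map $A\to S^{-1}A$ is in $\mathcal{M}$, $S^{-1}(I^{cl})=(S^{-1}I)^{cl}$ for every ideal $I$ of $A$. Here $S^{-1}A$ is the monoid of fractions $a/s$, with $a/s=b/t$ iff $uta=usb$ for some $u\in S$. *)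

(* Defs.v *)
From HB Require Import structures.
From mathcomp Require Import all_boot ssrAC.
From mathcomp Require Import boolp classical_sets.

Set Implicit Arguments.
Unset Strict Implicit.
Unset Printing Implicit Defensive.

Local Open Scope classical_set_scope.
Local Open Scope quotient_scope.
Local Open Scope group_scope.

(* Pointed commutative monoids.  The trivial monoid, in which 0 = 1, is
   allowed (it is the localization of any monoid at a set containing 0). *)
HB.mixin Record Monoid_isPointedComMonoid A of monoid.Monoid A := {
  pzero : A;
  pmulC : commutative (@mul A);
  pmul0m : left_zero pzero (@mul A)
}.

#[short(type="pcMonoidType")]
HB.structure Definition PointedComMonoid :=
  {A of Monoid_isPointedComMonoid A & monoid.Monoid A}.

HB.instance Definition _ (A : pcMonoidType) :=
  SemiGroup.isCommutativeLaw.Build A (@mul A) pmulC.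

Notation "0" := (@pzero _) : group_scope.

HB.mixin Record preservesZero (A B : pcMonoidType) (f : A -> B) := {
  pmorph0 : f 0 = 0
}.

HB.structure Definition PCMonoidMorphism (A B : pcMonoidType) :=
  {f of preservesZero A B f & @UMagmaMorphism A B f}.

Notation "{ 'pcmorphism' A -> B }" := (PCMonoidMorphism.type A B)
  (at level 0, A at level 98, B at level 99,
   format "{ 'pcmorphism'  A  ->  B }") : type_scope.

Lemma idfun_pmorph0 (A : pcMonoidType) : @idfun A 0 = 0.
Proof. by []. Qed.

HB.instance Definition _ (A : pcMonoidType) :=
  preservesZero.Build A A idfun (idfun_pmorph0 A).

Lemma comp_pmorph0 (A B C : pcMonoidType) (g : {pcmorphism B -> C})
  (f : {pcmorphism A -> B}) : (g \o f) 0 = 0.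
Proof. by rewrite /= !pmorph0. Qed.

HB.instance Definition _ (A B C : pcMonoidType) (g : {pcmorphism B -> C})
    (f : {pcmorphism A -> B}) :=
  preservesZero.Build A C (g \o f) (comp_pmorph0 g f).

Record subcategory := Subcategory {
  in_obj : pcMonoidType -> Prop;
  in_mor : forall A B : pcMonoidType, {pcmorphism A -> B} -> Prop;
  in_mor_dom : forall A B (f : {pcmorphism A -> B}), in_mor f -> in_obj A;
  in_mor_cod : forall A B (f : {pcmorphism A -> B}), in_mor f -> in_obj B;
  in_mor_id : forall A, in_obj A -> in_mor (idfun : {pcmorphism A -> A});
  in_mor_comp : forall A B C (g : {pcmorphism B -> C})
      (f : {pcmorphism A -> B}),
    in_mor g -> in_mor f -> in_mor (g \o f : {pcmorphism A -> C})
}.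

Definition all_monoids : subcategory :=
  @Subcategory (fun=> True) (fun _ _ _ => True)
    (fun _ _ _ _ => I) (fun _ _ _ _ => I) (fun _ _ => I)
    (fun _ _ _ _ _ _ _ => I).

Section Ideals.
Variable A : pcMonoidType.
Implicit Types (I J : set A) (cl : set A -> set A).

Definition is_ideal I : Prop :=
  I 0 /\ forall x a : A, I x -> I (x * a).

(* [cl] is total on subsets, but only its values on ideals are relevant. *)
Definition closure_operation cl : Prop :=
  [/\ forall I, is_ideal I -> is_ideal (cl I),
      forall I, is_ideal I -> I `<=` cl I,
      forall I J, is_ideal I -> is_ideal J -> I `<=` J -> cl I `<=` cl J
    & forall I, is_ideal I -> cl (cl I) = cl I].

Definition ideal_exp I (n : nat) : set A :=
  [set y | exists x : 'I_n -> A, (forall i, I (x i)) /\ y = \prod_(i < n) x i].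

Definition integral_closure I : set A :=
  [set x | exists n : nat, (0 < n)%N /\ ideal_exp I n (x ^+ n)].

End Ideals.

Definition extended_ideal (A B : pcMonoidType) (f : A -> B) (I : set A) :
  set B := [set f x * b | x in I & b in [set: B]].

Section Localization.
(* A multiplicative set is a submonoid: closed under products, and contains 1. *)
Variables (A : pcMonoidType) (S : umagmaClosed A).

Definition fraction : Type := {x : A * A | x.2 \in S}.
HB.instance Definition _ := Choice.on fraction.

Definition mkfraction (a s : A) (Ss : s \in S) : fraction :=
  exist (fun x : A * A => x.2 \in S) (a, s) Ss.

Definition fraction_eq (x y : fraction) : bool :=
  let: (a, s) := val x in let: (b, t) := val y in
  `[< exists2 u : A, u \in S & u * t * a = u * s * b >].

Lemma fraction_eqP (x y : fraction) :
  reflect (exists2 u : A, u \in S &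
             u * (val y).2 * (val x).1 = u * (val x).2 * (val y).1)
          (fraction_eq x y).
Proof. by case: x y => [[a s] Ss] [[b t] St]; apply: asboolP. Qed.

Lemma fraction_eq_refl : reflexive fraction_eq.
Proof. by move=> x; apply/fraction_eqP; exists 1 => //; exact: gpred1. Qed.

Lemma fraction_eq_sym : symmetric fraction_eq.
Proof. by move=> x y; apply/fraction_eqP/fraction_eqP => -[u Su e]; exists u. Qed.

Lemma fraction_eq_trans : transitive fraction_eq.
Proof.
move=> [[b t] /= St] [[a s] /= Ss] [[c r] /= Sr].
move=> /fraction_eqP[u /= Su e] /fraction_eqP[v /= Sv e'].
apply/fraction_eqP; exists (u * v * t) => /=; first by rewrite !gpredM.
transitivity ((v * r) * (u * t * a)); first by rewrite [LHS](ACl (2*4*(1*3*5))).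
rewrite e; transitivity ((u * s) * (v * r * b)).
  by rewrite [LHS](AC (2*3) ((3*4)*(1*2*5))).
by rewrite e' [LHS](AC (2*3) (1*3*4*2*5)).
Qed.

Canonical fraction_equiv :=
  EquivRel fraction_eq fraction_eq_refl fraction_eq_sym fraction_eq_trans.

Definition localization : Type := {eq_quot fraction_eq}.
HB.instance Definition _ := Choice.on localization.
HB.instance Definition _ := EqQuotient.on localization.

Definition frac (a s : A) (Ss : s \in S) : localization :=
  \pi_localization (mkfraction a Ss).

Lemma fracE (a s b t : A) (Ss : s \in S) (St : t \in S) :
  frac a Ss = frac b St <-> exists2 u : A, u \in S & u * t * a = u * s * b.
Proof.
split=> [/eqmodP|e]; first by move=> /fraction_eqP.
by apply/eqmodP/fraction_eqP.
Qed.

Lemma frac_surj (z : localization) :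
  exists a s (Ss : s \in S), z = frac a Ss.
Proof.
elim/quotW: z => -[[a s] /= Ss]; exists a, s, Ss.
by congr (\pi_localization _); apply: val_inj.
Qed.

Definition fraction_mul (x y : fraction) : fraction :=
  mkfraction ((val x).1 * (val y).1) (gpredM _ _ (valP x) (valP y)).

Definition loc_mul (z w : localization) : localization :=
  \pi_localization (fraction_mul (repr z) (repr w)).
Definition loc_one : localization := frac 1 gpred1.
Definition loc_zero : localization := frac 0 gpred1.

Lemma loc_mulE (a s b t : A) (Ss : s \in S) (St : t \in S) :
  loc_mul (frac a Ss) (frac b St) = frac (a * b) (gpredM _ _ Ss St).
Proof.
rewrite /loc_mul.
case Ex: (repr (frac a Ss)) => [[a' s'] /= Ss'].
case Ey: (repr (frac b St)) => [[b' t'] /= St'].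
have /fracE[u Su eu] : frac a' Ss' = frac a Ss by rewrite -[RHS]reprK Ex.
have /fracE[v Sv ev] : frac b' St' = frac b St by rewrite -[RHS]reprK Ey.
apply/eqmodP/fraction_eqP; exists (u * v) => /=; first by rewrite gpredM.
transitivity ((u * s * a') * (v * t * b')).
  by rewrite [LHS](AC (2*2*2) ((1*3*5)*(2*4*6))).
by rewrite eu ev [LHS](AC (3*3) ((1*4)*(2*5)*(3*6))).
Qed.

Lemma loc_mulC : commutative loc_mul.
Proof.
move=> z w; have [a [s [Ss ->]]] := frac_surj z; have [b [t [St ->]]] := frac_surj w.
rewrite !loc_mulE; apply/fracE; exists 1; first exact: gpred1.
by rewrite (pmulC a) (pmulC s).
Qed.

Lemma loc_mulA : associative loc_mul.
Proof.
move=> z w x; have [a [s [Ss ->]]] := frac_surj z.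
have [b [t [St ->]]] := frac_surj w; have [c [r [Sr ->]]] := frac_surj x.
rewrite !loc_mulE; apply/fracE; exists 1; first exact: gpred1.
by rewrite !mulgA.
Qed.

Lemma loc_mul1 : left_id loc_one loc_mul.
Proof.
move=> z; have [a [s [Ss ->]]] := frac_surj z.
rewrite loc_mulE; apply/fracE; exists 1; first exact: gpred1.
by rewrite !mul1g.
Qed.

Lemma loc_mulr1 : right_id loc_one loc_mul.
Proof. by move=> z; rewrite loc_mulC loc_mul1. Qed.

Lemma loc_mul0 : left_zero loc_zero loc_mul.
Proof.
move=> z; have [a [s [Ss ->]]] := frac_surj z.
rewrite loc_mulE; apply/fracE; exists 1; first exact: gpred1.
by rewrite pmul0m !mul1g (pmulC s) pmul0m.
Qed.

HB.instance Definition _ :=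
  isMonoid.Build localization loc_mulA loc_mul1 loc_mulr1.
HB.instance Definition _ :=
  Monoid_isPointedComMonoid.Build localization loc_mulC loc_mul0.

Definition localization_map (a : A) : localization := frac a gpred1.

Lemma localization_map_monoid_morphism : monoid_morphism localization_map.
Proof.
split=> // a b; rewrite [RHS]loc_mulE; apply/fracE.
by exists 1; [exact: gpred1 | rewrite !mul1g].
Qed.

Lemma localization_map0 : localization_map 0 = 0.
Proof. by []. Qed.

HB.instance Definition _ := isUMagmaMorphism.Build A localization
  localization_map localization_map_monoid_morphism.
HB.instance Definition _ := preservesZero.Build A localization
  localization_map localization_map0.

Definition localized_ideal (I : set A) : set localization :=
  [set z | exists a s (Ss : s \in S), I a /\ z = frac a Ss].

End Localization.

Arguments localized_ideal {A} S I.

Section ClosureProperties.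
Variables (M : subcategory) (cl : forall A : pcMonoidType, set A -> set A).

Definition persistent : Prop :=
  forall (A B : pcMonoidType) (f : {pcmorphism A -> B}) (I : set A),
    in_mor M f -> is_ideal I ->
    extended_ideal f (cl I) `<=` cl (extended_ideal f I).

Definition commutes_with_localization : Prop :=
  forall (A : pcMonoidType) (S : umagmaClosed A) (I : set A),
    in_obj M A ->
    in_mor M (@localization_map A S : {pcmorphism A -> localization S}) ->
    is_ideal I ->
    localized_ideal S (cl I) = cl (localized_ideal S I).

End ClosureProperties.

(* Main.v *)
Require Import Defs.
From mathcomp Require Import all_boot.
From mathcomp Require Import boolp classical_sets.

(** The powers of an ideal [I] behave like the graded pieces of a Rees algebra:
    [I^m I^n] lies in [I^(m+n)].  For a degree [n], consider the elements [y]
    some positive power [y^m] of which lies in [I^(n m)]: the degree [n] part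
    of the integral closure of that Rees algebra ([integral_part]).  Its degree
    one part is the integral closure of [I], and two facts make everything
    work: degrees add up under products ([integral_partM]), and an element
    whose [n]-th power has degree [n], for [n > 0], has degree one
    ([integral_part_root]).  If [x^n] is a product of [n] elements integral
    over [I], then [x^n] has degree [n] by the first fact, so [x] is integral
    over [I] by the second: the operation is idempotent.

    Persistence holds because a morphism carries an equation
    [x^n = x_1 ... x_n] to an equation of the same shape, together with the
    stability of the closure of an ideal under multiplication.  Localization is
    a special case in one direction, since [S^-1 I] is the extension of [I].
    In the other direction, one clears denominators: if [(a/s)^n] is in
    [(S^-1 I)^n], then [u t a^n = u s^n y] with [y] in [I^n] and [u], [t] in
    [S].  Multiplying by [(u t)^(n-1)] turns the left side into the [n]-th
    power of [u t a] and keeps the right side in [I^n], so [u t a] is integral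
    over [I], and [a/s = (u t a)/(u t s)]. *)

Set Implicit Arguments.
Unset Strict Implicit.
Unset Printing Implicit Defensive.

Local Open Scope classical_set_scope.
Local Open Scope group_scope.

Lemma pcmulgAC (A : pcMonoidType) : right_commutative (@mul A).
Proof. by move=> x y z; rewrite -!mulgA (pmulC y). Qed.

Lemma pcexpgMn (A : pcMonoidType) (x y : A) n : (x * y) ^+ n = x ^+ n * y ^+ n.
Proof. by rewrite expgMn //; apply: pmulC. Qed.

(** * Powers of ideals and integral closure *)

Section IdealPowers.
Variable A : pcMonoidType.
Implicit Types (I J : set A) (x y z a : A) (n m : nat).

Lemma ideal_exp0 I : ideal_exp I 0 1.
Proof. by exists (fun=> 1); split=> [[]|] //; rewrite big_ord0. Qed.

Lemma ideal_expSr I n y x :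
  ideal_exp I n y -> I x -> ideal_exp I n.+1 (y * x).
Proof.
move=> [f [If ->]] Ix.
exists (fun i => if unlift ord_max i is Some j then f j else x).
split=> [i|]; first by case: unliftP => // j _.
rewrite big_ord_recr /= unlift_none; congr (_ * _).
apply: eq_bigr => i _.
have -> : widen_ord (leqnSn n) i = lift ord_max i.
  by apply: val_inj; rewrite /= /bump leqNgt ltn_ord.
by rewrite liftK.
Qed.

(** Reading off the factors of a product one at a time avoids any choice of
    families of witnesses in the sequel. *)
Lemma ideal_exp_ind I (P : nat -> A -> Prop) :
    P 0%N 1 ->
    (forall n y x, ideal_exp I n y -> I x -> P n y -> P n.+1 (y * x)) ->
  forall n y, ideal_exp I n y -> P n y.
Proof.
move=> P0 PS; elim=> [|n IHn] y [f [If ->]]; first by rewrite big_ord0.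
rewrite big_ord_recr /=.
have If' : ideal_exp I n (\prod_(i < n) f (widen_ord (leqnSn n) i)).
  by exists (fun i => f (widen_ord (leqnSn n) i)).
by apply: PS => //; apply: IHn.
Qed.

Lemma ideal_exp1 I x : I x -> ideal_exp I 1 x.
Proof. by rewrite -{2}[x]mul1g; apply: ideal_expSr (ideal_exp0 I). Qed.

Lemma ideal_expD I n m y z :
  ideal_exp I n y -> ideal_exp I m z -> ideal_exp I (n + m) (y * z).
Proof.
move=> Iy; move: m z; apply: ideal_exp_ind => [|m z x _ Ix].
  by rewrite addn0 mulg1.
by rewrite addnS mulgA => Iyz; apply: ideal_expSr.
Qed.

Lemma ideal_expX I n m y :
  ideal_exp I n y -> ideal_exp I (n * m) (y ^+ m).
Proof.
move=> Iy; elim: m => [|m IHm]; first by rewrite muln0; apply: ideal_exp0.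
by rewrite mulnS expgS; apply: ideal_expD.
Qed.

(** In degree [0] this fails, as the zeroth power of any ideal is [{1}]. *)
Lemma ideal_expMr I n y a : is_ideal I -> (0 < n)%N ->
  ideal_exp I n y -> ideal_exp I n (y * a).
Proof.
move=> [_ IM] n_gt0 Iy; move: n y Iy n_gt0.
apply: ideal_exp_ind => // n y x Iy Ix _ _.
by rewrite -mulgA; apply: ideal_expSr => //; apply: IM.
Qed.

(** The degree [n] part of the integral closure of the Rees algebra of [I]. *)
Definition integral_part I n : set A :=
  [set y | exists2 m, (0 < m)%N & ideal_exp I (n * m) (y ^+ m)].

Lemma integral_closureE I : integral_closure I = integral_part I 1.
Proof.
apply/seteqP; split=> x [m].
  by move=> [m_gt0 Ixm]; exists m; rewrite ?mul1n.
by rewrite mul1n => m_gt0 Ixm; exists m.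
Qed.

(** If [y^m] and [z^q] witness the two degrees, then [m q] is an exponent that
    works for both factors at once. *)
Lemma integral_partM I n p y z :
  integral_part I n y -> integral_part I p z -> integral_part I (n + p) (y * z).
Proof.
move=> [m m_gt0 Iy] [q q_gt0 Iz]; exists (m * q)%N; first by rewrite muln_gt0 m_gt0.
rewrite pcexpgMn mulnDl; apply: ideal_expD.
  by rewrite mulnA expgnA; apply: ideal_expX.
by rewrite (mulnC m) mulnA expgnA; apply: ideal_expX.
Qed.

Lemma integral_part_root I n x :
  (0 < n)%N -> integral_part I n (x ^+ n) -> integral_part I 1 x.
Proof.
move=> n_gt0 [m m_gt0 Ix]; exists (n * m)%N; first by rewrite muln_gt0 n_gt0.
by rewrite mul1n expgnA.
Qed.

Lemma ideal_exp_integral I n y :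
  ideal_exp (integral_closure I) n y -> integral_part I n y.
Proof.
move: n y; apply: ideal_exp_ind => [|n y x _].
  by exists 1%N => //; apply: ideal_exp0.
by rewrite integral_closureE -[n.+1]addn1 => Ix Iy; apply: integral_partM.
Qed.

Lemma sub_integral_closure I : I `<=` integral_closure I.
Proof. by move=> x Ix; exists 1%N; split=> //; apply: ideal_exp1. Qed.

Lemma integral_closure_ideal I : is_ideal I -> is_ideal (integral_closure I).
Proof.
move=> idI; split; first by case: idI => I0 _; apply: sub_integral_closure.
move=> x a [n [n_gt0 Ix]]; exists n; split=> //.
by rewrite pcexpgMn; apply: ideal_expMr.
Qed.

Lemma integral_closure_idem I :
  integral_closure (integral_closure I) = integral_closure I.
Proof.
apply/seteqP; split; last exact: sub_integral_closure.
move=> x [n [n_gt0 /ideal_exp_integral Ix]].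
by rewrite integral_closureE; apply: integral_part_root Ix.
Qed.

End IdealPowers.

(** * Behaviour under morphisms *)

Section Morphisms.
Variables (A B : pcMonoidType) (f : {pcmorphism A -> B}).
Variables (I : set A) (J : set B).
Hypothesis fIJ : forall x, I x -> J (f x).

Lemma ideal_exp_morph n y : ideal_exp I n y -> ideal_exp J n (f y).
Proof.
move: n y; apply: ideal_exp_ind => [|n y x _ Ix Jy].
  by rewrite gmulf1; apply: ideal_exp0.
by rewrite gmulfM; apply: ideal_expSr => //; apply: fIJ.
Qed.

Lemma integral_closure_morph x :
  integral_closure I x -> integral_closure J (f x).
Proof.
move=> [n [n_gt0 Ix]]; exists n; split=> //.
by rewrite -gmulfXn; apply: ideal_exp_morph.
Qed.

End Morphisms.

Lemma integral_closure_operation (A : pcMonoidType) :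
  closure_operation (@integral_closure A).
Proof.
split=> [I|I _|I J _ _ IJ x|I _].
- exact: integral_closure_ideal.
- exact: sub_integral_closure.
- exact: (@integral_closure_morph _ _ (idfun : {pcmorphism A -> A})).
- exact: integral_closure_idem.
Qed.

Section Extension.
Variables (A B : pcMonoidType) (f : {pcmorphism A -> B}).

Lemma extended_ideal_ideal I : is_ideal I -> is_ideal (extended_ideal f I).
Proof.
move=> [I0 _]; split; first by exists 0 => //; exists 0 => //; rewrite pmorph0 pmul0m.
by move=> _ c [x Ix [b _ <-]]; exists x => //; exists (b * c) => //; rewrite mulgA.
Qed.

Lemma sub_extended_ideal (I : set A) x : I x -> extended_ideal f I (f x).
Proof. by move=> Ix; exists x => //; exists 1 => //; rewrite mulg1. Qed.

End Extension.

Lemma integral_closure_persistent : persistent all_monoids integral_closure.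
Proof.
move=> A B f I _ idI _ [x Ix [b _ <-]].
have [_ clM] := integral_closure_ideal (extended_ideal_ideal f idI).
by apply: clM; apply: integral_closure_morph Ix; apply: sub_extended_ideal.
Qed.

(** * Clearing denominators *)

Section Localization.
Variables (A : pcMonoidType) (S : umagmaClosed A).
Implicit Types (I : set A) (a b s t u : A).

Lemma fracM a s b t (Ss : s \in S) (St : t \in S) :
  frac a Ss * frac b St = frac (a * b) (gpredM _ _ Ss St).
Proof. exact: loc_mulE. Qed.

Lemma frac_eq a s b t (Ss : s \in S) (St : t \in S) :
  t * a = s * b -> frac a Ss = frac b St.
Proof.
by move=> e; apply/fracE; exists 1; rewrite ?gpred1 // !mul1g.
Qed.

Lemma fracX a s (Ss : s \in S) n :
  exists Ssn : s ^+ n \in S, (frac a Ss) ^+ n = frac (a ^+ n) Ssn.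
Proof.
elim: n => [|n [Ssn IHn]].
  by exists (gpred1 : s ^+ 0 \in S).
have Ssn1 : s ^+ n.+1 \in S by rewrite expgS gpredM.
exists Ssn1; rewrite expgS IHn fracM; apply: frac_eq.
by rewrite !expgS.
Qed.

(** This reduces one half of the compatibility with localization to
    persistence. *)
Lemma localized_idealE I : is_ideal I ->
  localized_ideal S I =
  extended_ideal (@localization_map A S : {pcmorphism A -> localization S}) I.
Proof.
move=> [_ IM]; apply/seteqP; split=> z.
  move=> [a [s [Ss [Ia ->]]]]; exists a => //; exists (frac 1 Ss) => //.
  by rewrite [LHS]fracM; apply: frac_eq; rewrite mul1g mulg1.
move=> [a Ia [w _ <-]]; have [b [t [St ->]]] := frac_surj w.
exists (a * b), t, St; split; first exact: IM.
by rewrite [LHS]fracM; apply: frac_eq; rewrite mul1g.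
Qed.

Lemma localized_ideal_exp I n z :
  ideal_exp (localized_ideal S I) n z -> localized_ideal S (ideal_exp I n) z.
Proof.
move: n z; apply: ideal_exp_ind => [|n y x _ [a [s [Ss [Ia ->]]]]].
  by exists 1, 1, gpred1; split=> //; apply: ideal_exp0.
move=> [b [t [St [Ib ->]]]]; rewrite fracM.
by exists (b * a), (t * s), (gpredM _ _ St Ss); split=> //; apply: ideal_expSr.
Qed.

(** Only finitely many denominators occur in the equation of integral
    dependence of [a/s]; multiplying [a] by them makes it integral over [I]
    itself without changing the fraction. *)
Lemma integral_closure_localized I : is_ideal I ->
  integral_closure (localized_ideal S I) `<=`
  localized_ideal S (integral_closure I).
Proof.
move=> idI z [n [n_gt0 Iz]]; have [a [s [Ss ez]]] := frac_surj z.
have [y [t [St [Iy ezn]]]] := localized_ideal_exp Iz.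
have [Ssn eX] := fracX a Ss n.
have [u Su e] : exists2 u, u \in S & u * t * a ^+ n = u * s ^+ n * y.
  by apply/(fracE _ _ Ssn St); rewrite -eX -ez.
have Sut : u * t \in S by rewrite gpredM.
exists (u * t * a), (u * t * s), (gpredM _ _ Sut Ss); split; last first.
  by rewrite ez; apply: frac_eq; rewrite [RHS]pmulC pcmulgAC.
exists n; split=> //.
(* The [n]-th power provides the factor [u t] of [e], with [n - 1] to spare. *)
have -> : (u * t * a) ^+ n = y * (u * s ^+ n * (u * t) ^+ n.-1).
  rewrite pcexpgMn -{1}(prednK n_gt0) expgS pcmulgAC e.
  by rewrite [_ * y]pmulC -mulgA.
exact: ideal_expMr.
Qed.

End Localization.

Lemma integral_closure_localization :
  commutes_with_localization all_monoids integral_closure.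
Proof.
move=> A S I _ _ idI; apply/seteqP; split; last exact: integral_closure_localized.
rewrite !localized_idealE //; last exact: integral_closure_ideal.
exact: integral_closure_persistent.
Qed.

Theorem proposition4p8 :
  (forall A : pcMonoidType, closure_operation (@integral_closure A)) /\
  (persistent all_monoids integral_closure /\
   commutes_with_localization all_monoids integral_closure).
Proof.
split; first exact: integral_closure_operation.
by split; [exact: integral_closure_persistent | exact: integral_closure_localization].
Qed.
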